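(* Every generalized Bassian group is a B+E-group.
   Context: All groups are abelian. A group $G$ is Bassian (respectively, generalized Bassian) if, for every subgroup $N$ of $G$, the existence of an injective homomorphism $G\to G/N$ implies that $N=\{0\}$ (respectively, that $N$ is a direct summand of $G$). A torsion group $E$ is elementary if, for every prime $p$, its $p$-primary component $E_p$ satisfies $pE_p=0$. A group $G$ is a B+E-group if it decomposes as $G=A\oplus E$, where $A$ is Bassian and $E$ is elementary. *)

(* Defs.v *)
From mathcomp Require Import all_boot all_algebra.

Set Implicit Arguments.
Unset Strict Implicit.
Unset Printing Implicit Defensive.

Import GRing.Theory.
Local Open Scope ring_scope.

(* Subgroups are [zmodClosed] boolean predicates: under classical logic every
   subset of a type is of this form, and every abelian group carries the
   choiceType structure required by [zmodType]. *)

Definition embeds (G H : zmodType) : Prop :=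
  exists f : {additive G -> H}, injective f.

Definition direct_summand (G : zmodType) (N : zmodClosed G) : Prop :=
  exists M : zmodClosed G,
    (forall x : G, x \in N -> x \in M -> x = 0) /\
    (forall x : G, exists y z : G, [/\ y \in N, z \in M & x = y + z]).

Definition bassian (G : zmodType) : Prop :=
  forall N : zmodClosed G, embeds G (Quotient.quot N) -> N =i pred1 (0 : G).

Definition generalized_bassian (G : zmodType) : Prop :=
  forall N : zmodClosed G, embeds G (Quotient.quot N) -> direct_summand N.

Definition torsion_group (E : zmodType) : Prop :=
  forall x : E, exists2 n : nat, (0 < n)%N & x *+ n = 0.

Definition in_primary_component (E : zmodType) (p : nat) (x : E) : Prop :=
  exists k : nat, x *+ (p ^ k)%N = 0.

Definition elementary (E : zmodType) : Prop :=
  torsion_group E /\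
  forall p : nat, prime p ->
    forall x : E, in_primary_component p x -> x *+ p = 0.

(* The decomposition is up to isomorphism, with the library's group structure
   on the product type as the external direct sum. *)
Definition BplusE_group (G : zmodType) : Prop :=
  exists A E : zmodType,
    [/\ bassian A, elementary E &
        exists f : {additive G -> (A * E)%type}, bijective f].

(* Main.v *)
Require Import Defs.
From HB Require Import structures.
From mathcomp Require Import all_boot all_order all_algebra ring.
From mathcomp Require Import boolp classical_sets cardinality.

(** Why a generalized Bassian group [G] is the sum of a Bassian group and an
    elementary one.

    All the information on [G] comes from [generalized_bassian_projection]: if
    two homomorphisms [r] and [g] from [G] to the same group are such that
    [g - r] takes its values in [r F], for a subgroup [F] on which [g] is
    injective, then [G] embeds in its quotient by [N], the kernel of [r] on [F],
    so that [N] is a summand of [G], and of [F]. Homomorphisms to a divisible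
    group extend from subgroups to [G]; hence a subgroup [F] that embeds in a
    divisible group [D] and also maps onto [D] must contain a copy of [D].
    When [F] is a direct sum of countably many cyclic groups, it contains no
    nonzero divisible subgroup, and this excludes from [G]
    - free groups of infinite rank (with [D = Q[X]]);
    - direct sums of cyclic p-groups of unbounded orders (with [D] a countable
      sum of Pruefer groups).
    Multiplication by [p] on a divisible p-subgroup and a variant with bounded
    orders then show that the p-component of [G] has bounded exponent and that
    [p G] contains only finitely many elements of order [p].

    So there is a finitely generated subgroup [Y] such that every element of [G]
    has a nonzero multiple in [Y], and for each prime [p] the intersection of
    [p G + Y] with the socle [G[p]] is finite. Let [N_p] be a complement of
    this intersection in [G[p]]. It meets [p G + Y] trivially, so that the vector
    space [G / (p G + Y)] over the field with [p] elements yields a projection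
    [rho_p] of [G] onto [N_p] that kills [Y]. An element [x] with [c x] in [Y] is
    then killed by [rho_p] for all [p] prime to [c], and so the [rho_p] add up to
    an idempotent endomorphism [rho] of [G]. Its image is elementary. Its kernel
    has finite p-components and contains no free group of infinite rank;
    [bassian_finite] shows that it is Bassian. *)

Set Implicit Arguments.
Unset Strict Implicit.
Unset Printing Implicit Defensive.

Import Order.TTheory GRing.Theory Num.Theory.
Local Open Scope ring_scope.
Local Open Scope quotient_scope.

(** * Subgroups, complements and projections *)

Definition subgroup (G : zmodType) (S : G -> Prop) : Prop :=
  S 0 /\ forall x y, S x -> S y -> S (x - y).

Lemma subrACA (G : zmodType) (a b c d : G) : a - b - (c - d) = a - c - (b - d).
Proof. by rewrite !opprB addrACA [- b + _]addrC -addrACA [d + _]addrC addrACA. Qed.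

Section Subgroup.
Variables (G : zmodType) (S : G -> Prop).
Hypothesis hS : subgroup S.

Lemma subgroup0 : S 0. Proof. exact: hS.1. Qed.

Lemma subgroupB x y : S x -> S y -> S (x - y). Proof. exact: hS.2. Qed.

Lemma subgroupN x : S x -> S (- x).
Proof. by move=> Sx; rewrite -sub0r; apply: subgroupB => //; apply: subgroup0. Qed.

Lemma subgroupD x y : S x -> S y -> S (x + y).
Proof. by move=> Sx Sy; rewrite -[y]opprK; apply: subgroupB => //; apply: subgroupN. Qed.

Lemma subgroupMn x n : S x -> S (x *+ n).
Proof.
move=> Sx; elim: n => [|n IHn]; first exact: subgroup0.
by rewrite mulrS; apply: subgroupD.
Qed.

Lemma subgroupMz x (c : int) : S x -> S (x *~ c).
Proof.
move=> Sx; case: c => n; first exact: subgroupMn.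
by rewrite NegzE mulrNz; apply/subgroupN/subgroupMn.
Qed.

Lemma subgroup_asbool_closed : GRing.zmod_closed (fun x : G => `[< S x >]).
Proof.
split; first exact/asboolP/subgroup0.
by move=> x y /asboolP Sx /asboolP Sy; apply/asboolP/subgroupB.
Qed.

Definition zmodClosed_of : zmodClosed G :=
  HB.pack_for (zmodClosed G) (fun x : G => `[< S x >])
    (GRing.isZmodClosed.Build G _ subgroup_asbool_closed).

End Subgroup.

Lemma zmodClosed_subgroup (G : zmodType) (N : zmodClosed G) :
  subgroup (fun x => x \in N).
Proof. by split=> [|x y Nx Ny]; [apply: rpred0 | apply: rpredB]. Qed.

(** The complement is a maximal subgroup [K] above [U] meeting [N] trivially.
    For [x] outside [K + N], the group generated by [K] and [x - e] would still
    meet [N] trivially; so [x - e], and then [x], lies in [K + N]. *)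
Lemma complement_exists (G : zmodType) (P U N : G -> Prop) :
  subgroup P -> subgroup U -> subgroup N ->
  (forall x, U x -> P x) -> (forall x, N x -> P x) ->
  (forall x, U x -> N x -> x = 0) ->
  (forall (K : G -> Prop) x, subgroup K -> (forall y, U y -> K y) ->
     (forall y, K y -> N y -> y = 0) -> P x ->
     exists2 e, N e & forall (c : int) k n,
        K k -> N n -> x *~ c = k + n -> K ((x - e) *~ c)) ->
  exists K, [/\ subgroup K, forall x, U x -> K x, forall x, K x -> P x,
    forall x, K x -> N x -> x = 0
    & forall x, P x -> exists k n, [/\ K k, N n & x = k + n]].
Proof.
move=> hP hU hN UP NP UN0 hx.
pose good (K : set G) := [/\ subgroup K, forall x, K x -> P x
   & forall x, K x -> N x -> x = 0].
(* Adding [U] to each set makes the union of the empty chain admissible. *)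
pose Q (A : set G) := good (fun x => A x \/ U x).
have [F FQ Ftot|A [[hK KP KN0] Amax]] := @Zorn_bigcup G Q.
  have pick X : F X -> good (fun x => X x \/ U x) by move/FQ.
  have get x y : (\bigcup_(X in F) X)%classic x -> (\bigcup_(X in F) X)%classic y ->
     exists X, [/\ F X, X x & X y].
    move=> [X FX Xx] [Y FY Yy]; have [XY|YX] := Ftot _ _ FX FY.
      by exists Y; split=> //; apply: XY.
    by exists X; split=> //; apply: YX.
  split=> [|x [[X FX Xx]|/UP//]|x [[X FX Xx]|Ux]].
  - split=> [|x y]; first by right; apply: subgroup0.
    move=> [Bx|Ux] [By|Uy].
    + have [X [FX Xx Xy]] := get _ _ Bx By; have [hX _ _] := pick _ FX.
      have [|?] := subgroupB hX (or_introl Xx) (or_introl Xy); last by right.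
      by left; exists X.
    + have [X FX Xx] := Bx; have [hX _ _] := pick _ FX.
      have [|?] := subgroupB hX (or_introl Xx) (or_intror Uy); last by right.
      by left; exists X.
    + have [X FX Xy] := By; have [hX _ _] := pick _ FX.
      have [|?] := subgroupB hX (or_intror Ux) (or_introl Xy); last by right.
      by left; exists X.
    + by right; apply: subgroupB.
  - by have [_ + _] := pick _ FX; apply; left.
  - by have [_ _ +] := pick _ FX; apply; left.
  - exact: UN0.
set K := (fun x => A x \/ U x) in hK KP KN0.
have Kmax (L : set G) : good L -> (forall x, K x -> L x) -> forall x, L x -> K x.
  move=> gL KL x Lx; apply: contrapT => nKx; apply: (Amax L).
    split=> [y Ay|LA]; first by apply: KL; left.
    by apply: nKx; left; apply: LA.
  have E : (fun x => L x \/ U x) = L.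
    by apply/funext => y; apply/propext; split=> [[//|Uy]|]; [apply: KL; right|left].
  by rewrite /Q E.
exists K; split=> //; first by move=> x Ux; right.
move=> x Px.
have [|e Ne he] := hx K x hK _ KN0 Px; first by move=> y Uy; right.
exists (x - e), e; split; rewrite ?subrK //.
pose L y := exists c : int, K (y - (x - e) *~ c).
apply: (Kmax L); last 1 first.
- by exists 1; rewrite mulr1z subrr; apply: subgroup0.
- split=> [|y [c Kyc]|y [c Kyc] Ny].
  + split; first by exists 0; rewrite mulr0z subrr; apply: subgroup0.
    move=> y z [c Kyc] [d Kzd]; exists (c - d).
    by rewrite mulrzBr subrACA; apply: subgroupB.
  + rewrite -[y](subrK ((x - e) *~ c)); apply: (subgroupD hP); first exact: KP.
    by apply: (subgroupMz hP); apply: (subgroupB hP) => //; apply: NP.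
  + apply: KN0 => //; rewrite -[y](subrK ((x - e) *~ c)); apply: (subgroupD hK) => //.
    apply: (he c (- (y - (x - e) *~ c)) (y + e *~ c)).
    * exact: subgroupN.
    * by apply: (subgroupD hN) => //; apply: (subgroupMz hN).
    * by rewrite opprB mulrzBl addrA subrK subrK.
- by move=> y Ky; exists 0; rewrite mulr0z subr0.
Qed.

(** Since [p x] lies in [U], a multiple [c x] lying in [K + N] either has [c]
    divisible by [p], and then lies in [K], or forces [x] itself into [K + N]. *)
Lemma complement_prime (G : zmodType) (P U N : G -> Prop) (p : nat) : prime p ->
  subgroup P -> subgroup U -> subgroup N ->
  (forall x, U x -> P x) -> (forall x, N x -> P x) ->
  (forall x, U x -> N x -> x = 0) -> (forall x, P x -> U (x *+ p)) ->
  exists K, [/\ subgroup K, forall x, U x -> K x, forall x, K x -> P x,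
    forall x, K x -> N x -> x = 0
    & forall x, P x -> exists k n, [/\ K k, N n & x = k + n]].
Proof.
move=> p_pr hP hU hN UP NP UN0 pU; apply: complement_exists => // K x hK UK KN0 Px.
have [[k [n [Kk Nn xE]]]|nx] := pselect (exists k n, [/\ K k, N n & x = k + n]).
  exists n => // c k' n' _ _ _; rewrite xE addrK; exact: subgroupMz.
exists 0; first exact: subgroup0.
move=> c k n Kk Nn cE; rewrite subr0.
have [/dvdzP[b ->]|pc] := boolP (p %| c)%Z.
  by rewrite mulrC mulrzA; apply: (subgroupMz hK); apply/UK; exact: (pU _ Px).
have : coprimez p c by rewrite coprimezE prime_coprime.
case/coprimezP => -[u v] /= uvE; case: nx.
exists (x *+ p *~ u + k *~ v), (n *~ v); split.
- by apply: (subgroupD hK); apply: (subgroupMz hK) => //; apply/UK/pU.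
- exact: (subgroupMz hN).
- by rewrite -addrA -mulrzDl -cE pmulrn -!mulrzA -mulrzDr mulrC
    [c * v]mulrC uvE mulr1z.
Qed.

(** Write [n x = k + d] with [n] positive and least, and divide [d] by [n]
    inside [N]: subtracting the quotient from [x] moves all the multiples of
    [x] lying in [K + N] into [K]. *)
Lemma complement_divisible (G : zmodType) (U N : G -> Prop) :
  subgroup U -> subgroup N -> (forall x, U x -> N x -> x = 0) ->
  (forall (n : nat) d, (0 < n)%N -> N d -> exists2 e, N e & d = e *+ n) ->
  exists K, [/\ subgroup K, forall x, U x -> K x,
    forall x, K x -> N x -> x = 0
    & forall x, exists k n, [/\ K k, N n & x = k + n]].
Proof.
move=> hU hN UN0 Ndiv.
suff [K [hK UK _ KN0 Ksum]] : exists K, [/\ subgroup K,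
    forall x, U x -> K x, forall x, K x -> True, forall x, K x -> N x -> x = 0
    & forall x, True -> exists k n, [/\ K k, N n & x = k + n]].
  by exists K; split=> // x; apply: Ksum.
apply: complement_exists => // K x hK UK KN0 _.
pose M (n : nat) := (0 < n)%N && `[< exists k d, [/\ K k, N d & x *+ n = k + d] >].
have [[n Mn]|noM] := pselect (exists n, M n); last first.
  exists 0; first exact: subgroup0.
  move=> c k n Kk Nn cE; rewrite subr0.
  have [->|c0] := eqVneq c 0; first by rewrite mulr0z; apply: subgroup0.
  case: noM; exists `|c|%N; rewrite /M absz_gt0 c0; apply/asboolP.
  exists (k *~ Num.sg c), (n *~ Num.sg c).
  split; [exact: (subgroupMz hK) | exact: (subgroupMz hN) |].
  by rewrite -mulrzDl -cE -mulrzA mulrC -normrEsg pmulrn abszE.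
pose n0 := ex_minn (ex_intro M n Mn).
have [] : M n0 /\ forall m, M m -> (n0 <= m)%N by rewrite /n0; case: ex_minnP.
move=> /andP[n0_gt0 /asboolP[k0 [d0 [Kk0 Nd0 E0]]]] n0min.
have [e Ne dE] := Ndiv _ _ n0_gt0 Nd0; exists e => // c k d Kk Nd cE.
have Kn0 : K ((x - e) *+ n0) by rewrite mulrnBl E0 dE addrK.
suff /dvdzP[b ->] : (n0 %| c)%Z by rewrite mulrC mulrzA; apply: subgroupMz.
apply/dvdz_mod0P; apply: contrapT => /eqP r0.
have r_ge0 : 0 <= (c %% n0)%Z by rewrite modz_ge0 // -lt0n.
have r_lt : (c %% n0)%Z < n0 by rewrite ltz_pmod.
suff : (n0 <= `|(c %% n0)%Z|)%N by rewrite leqNgt -ltz_nat gez0_abs // r_lt.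
apply: n0min.
rewrite /M absz_gt0 r0; apply/asboolP.
exists (k - k0 *~ (c %/ n0)%Z), (d - d0 *~ (c %/ n0)%Z); split.
- by apply: (subgroupB hK) => //; apply: (subgroupMz hK).
- by apply: (subgroupB hN) => //; apply: (subgroupMz hN).
- rewrite addrACA -opprD -mulrzDl -E0 -cE (pmulrn x n0) -mulrzA -mulrzBr.
  by rewrite pmulrn gez0_abs // /modz mulrC.
Qed.

Lemma projection_exists (G : zmodType) (K N : G -> Prop) :
  subgroup K -> subgroup N -> (forall x, K x -> N x -> x = 0) ->
  (forall x, exists k n, [/\ K k, N n & x = k + n]) ->
  exists rho : {additive G -> G}, [/\ forall x, N (rho x), forall x, K (x - rho x),
    forall x, N x -> rho x = x & forall x, K x -> rho x = 0].
Proof.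
move=> hK hN KN0 KN.
have [f fP] : {f : G -> G & forall x, N (f x) /\ K (x - f x)}.
  apply: (@choice _ _ (fun x y => N y /\ K (x - y))) => x.
  have [k [n [Kk Nn ->]]] := KN x.
  by exists n; rewrite addrK.
have fU x n : N n -> K (x - n) -> f x = n.
  move=> Nn Kn; have [Nf Kf] := fP x; apply: subr0_eq; apply: KN0.
    by have := subgroupB hK Kn Kf; rewrite opprB addrC addrA subrK.
  exact: (subgroupB hN).
have fadd : GRing.zmod_morphism f.
  move=> x y; have [[Nx Kx] [Ny Ky]] := (fP x, fP y); apply: fU.
    exact: subgroupB.
  by rewrite subrACA; apply: subgroupB.
pose rho : {additive G -> G} :=
  HB.pack_for {additive G -> G} f (GRing.isZmodMorphism.Build _ _ f fadd).
exists rho; split=> x /=.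
- by have [] := fP x.
- by have [] := fP x.
- by move=> Nx; apply: fU; rewrite // subrr; apply: subgroup0.
- by move=> Kx; apply: fU; rewrite ?subr0 //; apply: subgroup0.
Qed.

Lemma direct_summand_projection (G : zmodType) (N : zmodClosed G) :
  direct_summand N -> exists rho : {additive G -> G},
    (forall x, rho x \in N) /\ (forall x, x \in N -> rho x = x).
Proof.
move=> [M [NM0 NM]].
have [|x|rho [? _ ? _]] :=
    projection_exists (zmodClosed_subgroup M) (zmodClosed_subgroup N).
- by move=> x Mx Nx; apply: NM0.
- by have [y [z [Ny Mz ->]]] := NM x; exists z, y; rewrite addrC.
- by exists rho.
Qed.

(** Let [N] be the kernel of [r] on [F]. Any [x] can be moved by an element of
    [F] to some [y x] such that [r (y x) = g x], and [y x] is unique modulo [N].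
    If [y x] lies in [N], then [x] lies in [F] and [g x = 0], so [x = 0]: the
    group [G] embeds in [G / N], and [N] is a summand. *)
Lemma generalized_bassian_projection (G D : zmodType) (F : G -> Prop)
    (r g : {additive G -> D}) :
  generalized_bassian G -> subgroup F ->
  (forall x, exists2 z, F z & r z = g x - r x) ->
  (forall x, F x -> g x = 0 -> x = 0) ->
  exists rho : {additive G -> G},
    (forall x, F (rho x) /\ r (rho x) = 0) /\
    (forall x, F x -> r x = 0 -> rho x = x).
Proof.
move=> gbG hF hr hg.
have hN : subgroup (fun x => F x /\ r x = 0).
  split; first by rewrite raddf0; split=> //; apply: subgroup0.
  move=> x y [Fx rx] [Fy ry]; split; first exact: subgroupB.
  by rewrite raddfB rx ry subrr.
pose N := zmodClosed_of hN.
have [y yP] : {y : G -> G & forall x, F (y x - x) /\ r (y x) = g x}.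
  apply: (@choice _ _ (fun x z => F (z - x) /\ r z = g x)) => x.
  have [z Fz rz] := hr x; exists (z + x).
  by rewrite addrK raddfD rz subrK.
pose f x := \pi_(Quotient.quot N) (y x).
have fadd : GRing.zmod_morphism f.
  move=> a b; rewrite /f -raddfB; apply/eqP; rewrite -Quotient.idealrBE.
  have [[Fab rab] [[Fa ra] [Fb rb]]] := (yP (a - b), (yP a, yP b)).
  apply/asboolP; split; last first.
    by rewrite raddfB rab (raddfB g) (raddfB r) ra rb subrr.
  have := subgroupB hF Fab (subgroupB hF Fa Fb).
  by rewrite [y a - a - _]subrACA subrACA subrr subr0.
pose fm : {additive G -> Quotient.quot N} :=
  HB.pack_for {additive G -> Quotient.quot N} f (GRing.isZmodMorphism.Build _ _ f fadd).
have [|rho [rhoN rhoid]] := @direct_summand_projection G N; last first.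
  exists rho; split=> x; first by have /asboolP := rhoN x.
  by move=> Fx rx; apply: rhoid; apply/asboolP.
apply: gbG; exists fm; apply: raddf_inj => x /eqP.
rewrite /= /f -(raddf0 (\pi_(Quotient.quot N))) -Quotient.idealrBE subr0.
have [Fx rx] := yP x; move=> /asboolP[Fy ry].
apply: hg; last by rewrite -rx.
by have := subgroupB hF Fy Fx; rewrite opprB addrC subrK.
Qed.

(** * Independent families *)

(** Coefficient sequences of finite support are encoded as integer polynomials,
    whose addition is then that of linear combinations. *)
Definition comb (G : zmodType) (x : nat -> G) (a : {poly int}) : G :=
  \sum_(i < size a) x i *~ a`_i.

Section Comb.
Variables (G : zmodType) (x : nat -> G).

Lemma comb_widen m (a : {poly int}) :
  (size a <= m)%N -> comb x a = \sum_(i < m) x i *~ a`_i.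
Proof.
move=> am; rewrite /comb (big_ord_widen m (fun i => x i *~ a`_i)) //.
rewrite big_mkcond; apply: eq_bigr => i _; case: ltnP => // ai.
by rewrite nth_default // mulr0z.
Qed.

Lemma comb_zmod_morphism : GRing.zmod_morphism (comb x).
Proof.
move=> a b; pose m := maxn (size a) (size b).
have am : (size a <= m)%N by rewrite leq_maxl.
have bm : (size b <= m)%N by rewrite leq_maxr.
have abm : (size (a - b)%R <= m)%N.
  by apply: leq_trans (size_polyD _ _) _; rewrite size_polyN.
rewrite !(comb_widen am, comb_widen bm, comb_widen abm) -sumrB.
by apply: eq_bigr => i _; rewrite coefB mulrzBr.
Qed.

HB.instance Definition _ :=
  GRing.isZmodMorphism.Build {poly int} G (comb x) comb_zmod_morphism.

Lemma comb_polyC c : comb x c%:P = x 0%N *~ c.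
Proof.
by rewrite (@comb_widen 1) ?size_polyC_leq1 // big_ord1 coefC.
Qed.

Lemma comb_Xn i : comb x 'X^i = x i.
Proof.
rewrite (@comb_widen i.+1) ?size_polyXn // big_ord_recr big1 /=.
  by rewrite coefXn eqxx mulr1z add0r.
by move=> j _; rewrite coefXn ltn_eqF ?mulr0z.
Qed.

Lemma comb_recr m (a : {poly int}) : (size a <= m.+1)%N ->
  comb x a = comb x (take_poly m a) + x m *~ a`_m.
Proof.
move=> am; rewrite (comb_widen am) big_ord_recr (comb_widen (size_take_poly _ _)).
by congr (_ + _); apply: eq_bigr => i _; rewrite coef_take_poly ltn_ord.
Qed.

Lemma eq_comb_size (y : nat -> G) (a : {poly int}) :
  (forall i, (i < size a)%N -> x i = y i) -> comb x a = comb y a.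
Proof. by move=> xy; apply: eq_bigr => i _; rewrite xy. Qed.

Lemma comb_eq0 (n : nat -> nat) (a : {poly int}) :
  (forall i, x i *+ n i = 0) -> (forall i, (n i %| a`_i)%Z) -> comb x a = 0.
Proof.
move=> nx na; apply: big1 => i _; have /dvdzP[b ->] := na i.
by rewrite mulrC mulrzA -pmulrn nx mul0rz.
Qed.

End Comb.

Lemma raddf_comb (G D : zmodType) (h : {additive G -> D}) (x : nat -> G) a :
  h (comb x a) = comb (h \o x) a.
Proof. by rewrite raddf_sum; apply: eq_bigr => i _; rewrite raddfMz. Qed.

Definition spanned (G : zmodType) (x : nat -> G) (y : G) := exists a, y = comb x a.

Lemma spanned_subgroup (G : zmodType) (x : nat -> G) : subgroup (spanned x).
Proof.
split; first by exists 0; rewrite raddf0.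
by move=> _ _ [a ->] [b ->]; exists (a - b); rewrite raddfB.
Qed.

Lemma spanned_gen (G : zmodType) (x : nat -> G) i : spanned x (x i).
Proof. by exists 'X^i; rewrite comb_Xn. Qed.

(** When moreover [x i *+ n i] lies in [H] for all [i], the family generates
    modulo [H] the direct sum of the groups Z/(n i); the value [n i = 0] stands
    for an infinite cyclic summand. *)
Definition independent (G : zmodType) (H : G -> Prop) (n : nat -> nat)
    (x : nat -> G) : Prop :=
  forall a, H (comb x a) -> forall i, (n i %| a`_i)%Z.

(** The condition on a member of the family involves only the members before
    it, so that families can be built by successive choices. *)
Lemma independent_triangular (G : zmodType) (H : G -> Prop) n (x : nat -> G) :
  (forall i, x i *+ n i = 0) ->
  (forall i c (a : {poly int}), (size a <= i)%N -> H (x i *~ c - comb x a) -> (n i %| c)%Z) ->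
  independent H n x.
Proof.
move=> nx xtri a; move: {2}(size a) (leqnn (size a)) => m.
elim: m a => [|m IHm] a am Ha i; first by rewrite nth_default ?dvdz0 // (leq_trans am).
have nm : (n m %| a`_m)%Z.
  apply: (xtri _ _ (- take_poly m a)); first by rewrite size_polyN size_take_poly.
  by rewrite raddfN opprK addrC -comb_recr.
have [im|mi] := ltnP i m; last first.
  move: mi; rewrite leq_eqVlt => /predU1P[<-//|mi].
  by rewrite nth_default ?dvdz0 // (leq_trans am).
have := IHm (take_poly m a) (size_take_poly _ _) _ i; rewrite coef_take_poly im.
apply; move: Ha; rewrite (comb_recr _ am); have /dvdzP[b ->] := nm.
by rewrite mulrC mulrzA -pmulrn nx mul0rz addr0.
Qed.

Lemma greedy_sequence (T : Type) (P : seq T -> T -> Prop) :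
  (forall s, exists x, P s x) -> exists x : nat -> T, forall i, P (mkseq x i) (x i).
Proof.
move=> hP; have [f fP] := @choice _ _ P hP.
pose L n := iter n (fun s => rcons s (f s)) [::].
exists (fun n => f (L n)) => i; suff -> : mkseq (fun n => f (L n)) i = L i by [].
by elim: i => // i IHi; rewrite mkseqS IHi.
Qed.

(** The property [Q] is what a new choice may assume of the former ones. *)
Lemma independent_exists (G : zmodType) (H : G -> Prop) (n : nat -> nat)
    (Q : nat -> G -> Prop) :
  (forall i x, Q i x -> x *+ n i = 0) ->
  (forall s : seq G, (forall j, (j < size s)%N -> Q j s`_j) ->
     exists2 x, Q (size s) x & forall c (a : {poly int}), (size a <= size s)%N ->
       H (x *~ c - comb (nth 0 s) a) -> (n (size s) %| c)%Z) ->
  exists2 x, independent H n x & forall i, Q i (x i).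
Proof.
move=> nQ step.
have [s|x xP] := @greedy_sequence G (fun s x =>
    (forall j, (j < size s)%N -> Q j s`_j) ->
    Q (size s) x /\ forall c (a : {poly int}), (size a <= size s)%N ->
      H (x *~ c - comb (nth 0 s) a) -> (n (size s) %| c)%Z).
  have [/step[x Qx xP]|nQs] := pselect (forall j, (j < size s)%N -> Q j s`_j).
    by exists x.
  by exists 0 => /nQs.
have Qx i : Q i (x i).
  elim/ltn_ind: i => i IHi; have := xP i; rewrite size_mkseq; case=> // j ji.
  by rewrite nth_mkseq //; apply: IHi.
exists x => //; apply: independent_triangular => [i|i c a ai Ha]; first exact: nQ.
have := xP i; rewrite size_mkseq; case=> [j ji|_ /(_ c a ai)].
  by rewrite nth_mkseq.
apply; rewrite (@eq_comb_size _ _ x) // => j ja.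
by rewrite nth_mkseq // (leq_trans ja).
Qed.

(** * Homomorphisms into divisible groups *)

Lemma pairMn (G D : zmodType) (v : G) (w : D) m : (v, w) *+ m = (v *+ m, w *+ m).
Proof. by elim: m => //= m IHm; rewrite !mulrS IHm. Qed.

Definition divisible (D : zmodType) : Prop :=
  forall (n : nat) (d : D), (0 < n)%N -> exists e, d = e *+ n.

(** A partial homomorphism is given by its graph; a complement of [0 * D] in
    [G * D] containing this graph is the graph of a total extension. *)
Lemma hom_extension (G D : zmodType) (S : G * D -> Prop) :
  divisible D -> subgroup S -> (forall d, S (0, d) -> d = 0) ->
  exists h : {additive G -> D}, forall x d, S (x, d) -> h x = d.
Proof.
move=> divD hS S0; pose N (u : G * D) := u.1 = 0.
have hN : subgroup N.
  by split=> // u v; rewrite /N /= => -> ->; rewrite subrr.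
have [||K [hK SK KN0 KN]] := complement_divisible hS hN.
- by move=> [x d]; rewrite /N /= => Sxd x0; move: Sxd; rewrite x0 => /S0->.
- move=> n [x d] n0; rewrite /N /= => ->; have [e ->] := divD n d n0.
  by exists (0, e); rewrite // pairMn mul0rn.
have [rho [rhoN _ rhoid rho0]] := projection_exists hK hN KN0 KN.
pose f x := - (rho (x, 0)).2.
have fadd : GRing.zmod_morphism f.
  move=> x y; rewrite /f.
  have -> : (x - y, 0) = (x, 0) - (y, 0) :> G * D by congr (_, _); rewrite /= subrr.
  by rewrite raddfB opprD.
exists (HB.pack_for {additive G -> D} f (GRing.isZmodMorphism.Build _ _ f fadd)).
move=> x d /SK/rho0 E /=; rewrite /f.
have -> : (x, 0) = (x, d) - (0, d) :> G * D by congr (_, _); rewrite /= ?subr0 ?subrr.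
by rewrite raddfB E rhoid //= sub0r opprK.
Qed.

(** The elements [d i] only have to satisfy the relations of the [x i]; that [H]
    is killed bounds the values of the extension when [H = q G]. *)
Lemma hom_of_independent (G D : zmodType) (H : G -> Prop) n (x : nat -> G)
    (d : nat -> D) :
  divisible D -> subgroup H -> independent H n x -> (forall i, d i *+ n i = 0) ->
  exists h : {additive G -> D},
    (forall a, h (comb x a) = comb d a) /\ (forall y, H y -> h y = 0).
Proof.
move=> divD hH ind nd.
pose S (u : G * D) := exists a, H (u.1 - comb x a) /\ u.2 = comb d a.
have hS : subgroup S.
  split; first by exists 0; rewrite !(raddf0 (comb _)) subr0; split=> //; apply: subgroup0.
  move=> [u1 u2] [v1 v2] [a [/= Hu ->]] [b [/= Hv ->]]; exists (a - b) => /=.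
  by rewrite !(raddfB (comb _)) subrACA; split=> //; apply: subgroupB.
have [e [a /= []]|h hP] := hom_extension divD hS.
  rewrite sub0r => /(subgroupN hH); rewrite opprK => /ind na ->.
  exact: comb_eq0 na.
exists h; split=> [a|y Hy]; apply: hP.
  by exists a; rewrite /= subrr; split=> //; apply: subgroup0.
by exists 0; rewrite /= !(raddf0 (comb _)) subr0.
Qed.

(** This prevents the span from containing a copy of a divisible group. *)
Lemma independent_reduced (G : zmodType) n (x : nat -> G) y :
  (forall i, x i *+ n i = 0) -> independent (eq 0) n x ->
  (forall m : nat, (0 < m)%N -> exists2 z, spanned x z & y = z *+ m) -> y = 0.
Proof.
move=> nx ind ydiv; have [_ [a ->] ya] := ydiv 1%N isT.
rewrite {}ya mulr1n in ydiv *; apply: (comb_eq0 nx) => i.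
(* Divisibility by this [m] makes the i-th coefficient vanish: modulo [n i],
   or absolutely because of its size. *)
pose m := if n i == 0%N then `|a`_i|.+1 else n i.
have m_gt0 : (0 < m)%N by rewrite /m; case: eqVneq => // ?; rewrite lt0n.
have [_ [b ->] /eqP] := ydiv m m_gt0.
rewrite -raddfMn -subr_eq0 -raddfB => /eqP/esym/ind/(_ i).
rewrite coefB coefMn /m; case: eqVneq => [->|_] in m m_gt0 *.
  rewrite dvd0z subr_eq0 => /eqP E; have [b0|b0] := eqVneq b`_i 0.
    by rewrite E b0 mul0rn.
  have : absz a`_i = (absz (b`_i)%R * (absz (a`_i)%R).+1)%N by rewrite {1}E -mulr_natr natz abszM.
  by move=> /eqP; rewrite ltn_eqF // leq_pmull // absz_gt0.
by move=> dvd; rewrite -(subrK (b`_i *+ n i) a`_i) rpredD // -mulr_natr natz dvdz_mull.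
Qed.

(** A direct sum of cyclic groups [F] that embeds in, and maps onto, the same
    divisible group [D] cannot lie in [G]: one would get a complement in [F] of
    the kernel of [F -> D], hence a copy of [D] in the reduced group [F]. *)
Lemma no_independent_family (G D : zmodType) n (x : nat -> G) (d e : nat -> D) :
  generalized_bassian G -> divisible D ->
  (forall i, x i *+ n i = 0) -> independent (eq 0) n x ->
  (forall i, d i *+ n i = 0) -> (forall u, exists i, d i = u) ->
  (forall i, e i *+ n i = 0) -> independent (eq 0) n e ->
  forall u : D, u = 0.
Proof.
move=> gbG divD nx indx nd dsurj ne inde.
have h0 : subgroup (eq (0 : G)) by split=> // _ _ <- <-; rewrite subrr.
have [r [rx _]] := hom_of_independent divD h0 indx nd.
have [g [gx _]] := hom_of_independent divD h0 indx ne.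
have hF := spanned_subgroup x.
have rsurj u : exists2 z, spanned x z & r z = u.
  have [i <-] := dsurj u; exists (x i); first exact: spanned_gen.
  by rewrite -(comb_Xn x) rx comb_Xn.
have [||rho [rhoN rhoid]] := generalized_bassian_projection (r := r) (g := g) gbG hF.
- by move=> y; apply: rsurj.
- by move=> _ [a ->]; rewrite gx => /esym/inde; apply: comb_eq0.
move=> u; have [y Fy <-] := rsurj u.
suff : y - rho y = 0 by move/subr0_eq->; have [] := rhoN y.
apply: (independent_reduced nx indx) => m m_gt0.
have [v rv] := divD m (r y) m_gt0; have [z Fz rz] := rsurj v.
exists (z - rho z); first by apply: subgroupB => //; have [] := rhoN z.
have /rhoid : spanned x (y - z *+ m) by apply: subgroupB => //; apply: subgroupMn.
rewrite raddfB raddfMn rz -rv subrr raddfB raddfMn => /(_ erefl) E.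
by apply: subr0_eq; rewrite mulrnBl subrACA E subrr.
Qed.

(** * Two countable divisible groups *)

Lemma ratpoly_divisible : divisible {poly rat}.
Proof.
move=> n d n_gt0; exists (n%:R^-1 *: d).
by rewrite -scaler_nat scalerA mulfV ?scale1r // pnatr_eq0 -lt0n.
Qed.

Lemma coef_comb_scale (c : nat -> rat) (a : {poly int}) j :
  (comb (fun i => c i *: 'X^i) a)`_j = c j * (a`_j)%:~R.
Proof.
rewrite (@comb_widen _ _ (maxn (size a) j.+1)) ?leq_maxl // coef_sum.
have jm : (j < maxn (size a) j.+1)%N by rewrite leq_max leqnn orbT.
rewrite (bigD1 (Ordinal jm)) //= big1 ?addr0.
  by rewrite coefMrz coefZ coefXn eqxx mulr1 mulrzr.
move=> i /eqP ij; rewrite coefMrz coefZ coefXn.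
case: eqP => [E|_]; last by rewrite mulr0 mul0rz.
by case: ij; apply: val_inj.
Qed.

Section LocalizedQuotient.
Variable p : nat.

Definition p_local (f : {poly rat}) : Prop :=
  exists m (b : {poly int}), coprime p m /\ f *+ m = map_poly intr b.

Lemma p_local_subgroup : subgroup p_local.
Proof.
split; first by exists 1%N, 0; rewrite coprimen1 mul0rn rmorph0.
move=> f g [m [b [pm fE]]] [l [c [pl gE]]]; exists (m * l)%N, (b *+ l - c *+ m).
rewrite coprimeMr pm pl; split=> //.
by rewrite mulrnBl {1}mulrnA fE [(m * l)%N]mulnC mulrnA gE rmorphB !rmorphMn.
Qed.

(** The quotient of Q[X] by the polynomials with p-integral coefficients, a
    direct sum of countably many copies of the Pruefer group of [p]. *)
Definition prufer_sum : zmodType := Quotient.quot (zmodClosed_of p_local_subgroup).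

Definition prufer_pi (f : {poly rat}) : prufer_sum := \pi_prufer_sum f.

Lemma prufer_pi_zmod_morphism : GRing.zmod_morphism prufer_pi.
Proof. by move=> f g; rewrite /prufer_pi raddfB. Qed.

HB.instance Definition _ :=
  GRing.isZmodMorphism.Build {poly rat} prufer_sum prufer_pi prufer_pi_zmod_morphism.

Lemma prufer_pi_eq0 f : prufer_pi f = 0 <-> p_local f.
Proof.
rewrite /prufer_pi -(raddf0 \pi_prufer_sum); split.
  by move/eqP; rewrite -Quotient.idealrBE subr0 => /asboolP.
by move=> pf; apply/eqP; rewrite -Quotient.idealrBE subr0; apply/asboolP.
Qed.

Lemma prufer_pi_surj u : exists f, prufer_pi f = u.
Proof. by exists (repr u); apply: reprK. Qed.

Lemma prufer_divisible : divisible prufer_sum.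
Proof.
move=> n u n_gt0; have [f <-] := prufer_pi_surj u.
have [g ->] := ratpoly_divisible f n_gt0.
by exists (prufer_pi g); rewrite raddfMn.
Qed.

Hypothesis p_pr : prime p.

Lemma prufer_primary (u : prufer_sum) : exists j, u *+ (p ^ j)%N = 0.
Proof.
have [f <-] := prufer_pi_surj u; have [b [c c0 ->]] := rat_poly_scale f.
have [m pm cE] : {m | coprime p m & absz c = (m * p ^ logn p (absz c))%N}.
  by apply: pfactor_coprime; rewrite // absz_gt0.
exists (logn p (absz c)); rewrite -raddfMn; apply/prufer_pi_eq0.
exists m, (b *~ Num.sg c); split=> //.
rewrite -mulrnA mulnC -cE -scaler_nat scalerA rmorphMz.
rewrite -scaler_int; congr (_ *: _).
have cQ : c%:~R != 0 :> rat by rewrite intr_eq0.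
apply: (mulIf cQ); rewrite mulfVK // pmulrn abszE.
by rewrite -intrM -normrEsg.
Qed.

Variable k : nat -> nat.
Definition prufer_gen i := prufer_pi ((p ^ k i)%:R^-1 *: 'X^i).

Lemma prufer_gen_order i : prufer_gen i *+ (p ^ k i)%N = 0.
Proof.
rewrite -raddfMn -scaler_nat scalerA mulfV ?scale1r; last first.
  by rewrite pnatr_eq0 -lt0n expn_gt0 prime_gt0.
apply/prufer_pi_eq0; exists 1%N, 'X^i.
by rewrite coprimen1 map_polyXn.
Qed.

Lemma prufer_gen_independent : independent (eq 0) (fun i => p ^ k i)%N prufer_gen.
Proof.
move=> a /esym; rewrite -(raddf_comb prufer_pi) => /prufer_pi_eq0.
move=> [m [b [pm E]]] i; have := congr1 (fun f : {poly rat} => f`_i) E.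
rewrite coefMn coef_comb_scale coef_map /= => Ei.
have n0 : (p ^ k i)%:R != 0 :> rat.
  by rewrite pnatr_eq0 -lt0n expn_gt0 prime_gt0.
have {}Ei : a`_i * m = b`_i * (p ^ k i)%N.
  apply/eqP; rewrite -(eqr_int rat) !intrM -Ei -[_ *+ m]mulr_natr; apply/eqP.
  by rewrite -!pmulrn [RHS]mulrC !mulrA (mulfV n0) mul1r.
have : ((p ^ k i)%N %| a`_i * m)%Z by rewrite Ei dvdz_mull.
by rewrite Gauss_dvdzl // coprimezE coprimeXl.
Qed.

End LocalizedQuotient.

(** * Subgroups excluded from generalized Bassian groups *)

(** In [Q[X]], which is countable, the powers of ['X] are independent. *)
Lemma no_independent_torsion_free (G : zmodType) (x : nat -> G) :
  generalized_bassian G -> ~ independent (eq 0) (fun=> 0%N) x.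
Proof.
move=> gbG ind; pose d i : {poly rat} := odflt 0 (unpickle i).
have inde : independent (eq 0) (fun=> 0%N) (fun i => 1 *: 'X^i : {poly rat}).
  move=> a E i; rewrite dvd0z -(eqr_int rat).
  have := coef_comb_scale (fun=> 1) a i; rewrite -E coef0 mul1r => <-.
  by rewrite eqxx.
have dsurj (u : {poly rat}) : exists i, d i = u.
  by exists (pickle u); rewrite /d pickleK.
have /eqP := no_independent_family gbG ratpoly_divisible (fun=> mulr0n _) ind
   (fun=> mulr0n _) dsurj (fun=> mulr0n _) inde 1.
by rewrite oner_eq0.
Qed.

(** A countable direct sum of Pruefer groups is a p-group, so that it can be
    enumerated with the i-th element killed by [p ^ i.+1]. *)
Lemma no_independent_unbounded (G : zmodType) p (x : nat -> G) :
  prime p -> generalized_bassian G ->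
  (forall i, x i *+ (p ^ i.+1)%N = 0) ->
  ~ independent (eq 0) (fun i => p ^ i.+1)%N x.
Proof.
move=> p_pr gbG nx ind.
(* The exponent of 2 in [i.+1] selects the element; a factor [3 ^ j] makes [i]
   as large as its order requires. *)
pose u i := prufer_pi p (odflt 0 (unpickle (logn 2 i.+1))).
pose d i := if u i *+ (p ^ i.+1)%N == 0 then u i else 0.
have nd i : d i *+ (p ^ i.+1)%N = 0 by rewrite /d; case: eqP; rewrite // mul0rn.
have dsurj v : exists i, d i = v.
  have [j jv] := prufer_primary p_pr v; have [f fv] := prufer_pi_surj v.
  pose i := (2 ^ pickle f * 3 ^ j)%N; have i_gt0 : (0 < i)%N by rewrite muln_gt0 !expn_gt0.
  have ui : u i.-1 = v.
    rewrite /u prednK // lognM ?expn_gt0 // pfactorK // lognX (_ : logn 2 3 = 0%N) // muln0 addn0 pickleK.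
    exact: fv.
  exists i.-1; rewrite /d ui prednK //.
  have ji : (j <= i)%N.
    apply: leq_trans (ltnW (ltn_expl j (isT : (1 < 3)%N))) _.
    by rewrite leq_pmull // expn_gt0.
  by rewrite -(subnKC ji) expnD mulrnA jv mul0rn eqxx.
have := no_independent_family gbG (@prufer_divisible p) nx ind nd dsurj
   (@prufer_gen_order p p_pr S) (@prufer_gen_independent p p_pr S).
move=> all0; have := @prufer_gen_independent _ p_pr S 1 _ 0%N.
rewrite coef1 eqxx /= dvdz1 expn1 => /(_ (esym (all0 _)))/eqP p1.
by have := prime_gt1 p_pr; rewrite -[p]/(absz p) p1.
Qed.

Lemma coprime_divisible (G : zmodType) (w : G) (m n : nat) :
  coprime m n -> w *+ n = 0 -> exists c : int, w = w *~ c *+ m.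
Proof.
move=> mn wn; have : coprimez m n by rewrite coprimezE.
case/coprimezP => -[u v] /= uvE; exists u.
by rewrite pmulrn -mulrzA -[LHS]mulr1z -uvE mulrzDr [v * _]mulrC (mulrzA w n v) -pmulrn wn
   mul0rz addr0.
Qed.

Lemma primary_divisible (G : zmodType) p (W : G -> Prop) : prime p -> subgroup W ->
  (forall w, W w -> exists j, w *+ (p ^ j)%N = 0) ->
  (forall w, W w -> exists2 v, W v & w = v *+ p) ->
  forall n w, (0 < n)%N -> W w -> exists2 v, W v & w = v *+ n.
Proof.
move=> p_pr hW Wp Wdiv n w n_gt0 Ww.
have [m pm ->] : {m | coprime p m & n = (m * p ^ logn p n)%N}.
  exact: pfactor_coprime.
have [v Wv ->] : exists2 v, W v & w = v *+ (p ^ logn p n)%N.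
  elim: (logn p n) => [|j [v Wv ->]]; first by exists w; rewrite // mulr1n.
  by have [v' Wv' ->] := Wdiv v Wv; exists v'; rewrite // expnS mulrnA.
have [j vj] := Wp v Wv.
have [|c {1}->] := @coprime_divisible _ v m (p ^ j) _ vj.
  by rewrite coprime_sym coprimeXl.
by exists (v *~ c); [exact: subgroupMz | rewrite mulrnA].
Qed.

Definition subgroup_type (G : zmodType) (N : zmodClosed G) := {x : G | x \in N}.

HB.instance Definition _ (G : zmodType) (N : zmodClosed G) :=
  SubChoice.on (subgroup_type N).
HB.instance Definition _ (G : zmodType) (N : zmodClosed G) :=
  [SubChoice_isSubZmodule of subgroup_type N by <:].

(** Let [r] and [g] extend to [G] the multiplication by [p] and the identity of
    [W]. An element [w] of [W] of order [p] is then fixed by the projection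
    [rho] onto the kernel of [r] on [W]; but [w = p v] with [v] in [W], and
    [rho v] is killed by [p], so [w = p (rho v) = 0]. *)
Lemma no_divisible_primary (G : zmodType) p (W : G -> Prop) :
  prime p -> generalized_bassian G -> subgroup W ->
  (forall w, W w -> exists j, w *+ (p ^ j)%N = 0) ->
  (forall w, W w -> exists2 v, W v & w = v *+ p) ->
  forall w, W w -> w = 0.
Proof.
move=> p_pr gbG hW Wp Wdiv; pose D : zmodType := subgroup_type (zmodClosed_of hW).
have WD (w : D) : W (val w) by apply/asboolP; exact: (valP w).
have lift w : W w -> exists d : D, val d = w.
  move=> Ww; have wW : w \in zmodClosed_of hW by apply/asboolP.
  by exists (Sub w wW : D).
have divD : divisible D.
  move=> n d n_gt0.
  have [v Wv vE] := primary_divisible p_pr hW Wp Wdiv n_gt0 (WD d).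
  have [u uv] := lift v Wv; exists u; apply: val_inj.
  by rewrite raddfMn vE -uv.
have ext n : exists h : {additive G -> D}, forall d : D, h (val d) = d *+ n.
  pose S (u : G * D) := exists d : D, u.1 = val d /\ u.2 = d *+ n.
  have [||h hP] := @hom_extension G D S divD.
  - split; first by exists 0; rewrite raddf0 mul0rn.
    move=> [u1 u2] [v1 v2] [a [/= -> ->]] [b [/= -> ->]]; exists (a - b).
    by rewrite raddfB mulrnBl.
  - move=> d [a [a0 dE]].
    have a00 : a = 0 by apply: val_inj; rewrite raddf0; exact: esym a0.
    by rewrite a00 mul0rn in dE.
  by exists h => d; apply: hP; exists d.
have [[r rP] [g gP]] := (ext p, ext 1%N).
have [||rho [rhoW rhoid]] := generalized_bassian_projection (r := r) (g := g) gbG hW.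
- move=> x; have [v vE] := divD p (g x - r x) (prime_gt0 p_pr).
  by exists (val v); rewrite ?rP.
- by move=> w /lift[d <-]; rewrite gP mulr1n => ->; rewrite raddf0.
have Wp0 w : W w -> w *+ p = 0 -> w = 0.
  move=> Ww wp; have rw : r w = 0.
    have [d dw] := lift w Ww; rewrite -dw rP; apply: val_inj.
    by rewrite raddfMn raddf0 -wp -dw.
  have [v Wv vE] := Wdiv w Ww; rewrite -(rhoid w Ww rw) vE raddfMn /=.
  have [/lift[d dv] rv] := rhoW v; move: rv; rewrite -dv rP => /(congr1 val).
  by rewrite raddfMn raddf0.
move=> w Ww; have [j] := Wp w Ww; elim: j => [|j IHj]; first by rewrite mulr1n.
rewrite expnSr mulrnA => wj; apply: IHj; apply: Wp0 => //; exact: subgroupMn.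
Qed.

(** Let [q = p ^ k.+1] and let [D] be a sum of Pruefer groups. The map [r] sends
    the span [F] of the family onto [p D[q] * D[q]], using the even members for
    the first factor and the odd ones for the second; the map [g] embeds [F] in
    the second factor. Splitting [r] on [F] would make [p D[q]], of exponent
    [p ^ k], a summand of [F]. But [F] is free over Z/q, so its elements killed
    by [p ^ k] are multiples of [p], whereas the elements of order [p ^ k] of
    [p D[q]] are not multiples of [p] there. *)
Lemma no_independent_bounded (G : zmodType) p k (x : nat -> G) :
  prime p -> (0 < k)%N -> generalized_bassian G ->
  (forall i, x i *+ (p ^ k.+1)%N = 0) ->
  ~ independent (fun y => exists z, y = z *+ (p ^ k.+1)%N) (fun=> p ^ k.+1)%N x.
Proof.
move=> p_pr k_gt0 gbG nx; set q := (p ^ k.+1)%N in nx *; set H := fun y : G => _.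
move=> ind; pose D := prufer_sum p; have divD : divisible D by apply: prufer_divisible.
have hH : subgroup H.
  split; first by exists 0; rewrite mul0rn.
  by move=> _ _ [y ->] [z ->]; exists (y - z); rewrite mulrnBl.
pose e i : D := prufer_gen p (fun=> k.+1) i.
have ne i : e i *+ q = 0 := @prufer_gen_order p p_pr (fun=> k.+1) i.
pose u i := prufer_pi p (odflt 0 (unpickle i)).
pose d i := if u i *+ q == 0 then u i else 0.
have nd i : d i *+ q = 0 by rewrite /d; case: eqP; rewrite // mul0rn.
have dsurj v : v *+ q = 0 -> exists i, d i = v.
  have [f <-] := prufer_pi_surj v => fq; exists (pickle f).
  by rewrite /d /u pickleK /= fq eqxx.
have hom (c : nat -> D) : (forall i, c i *+ q = 0) -> exists h : {additive G -> D},
    (forall a, h (comb x a) = comb c a) /\ forall y, h y *+ q = 0.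
  move=> nc; have [h [hx hH0]] := hom_of_independent divD hH ind nc.
  exists h; split=> [//|y].
  by rewrite -raddfMn hH0 //; exists y.
have [h0 [h0x h0q]] := hom e ne.
have [|h1 [h1x h1q]] := hom (fun i => if odd i then 0 else d i./2).
  by move=> i; case: odd; rewrite // mul0rn.
have [|h2 [h2x h2q]] := hom (fun i => if odd i then d i./2 else 0).
  by move=> i; case: odd; rewrite // mul0rn.
have h1e i : h1 (x i.*2) = d i by rewrite -(comb_Xn x) h1x comb_Xn odd_double doubleK.
have h2e i : h2 (x i.*2) = 0 by rewrite -(comb_Xn x) h2x comb_Xn odd_double.
have h1o i : h1 (x i.*2.+1) = 0 by rewrite -(comb_Xn x) h1x comb_Xn /= odd_double.
have h2o i : h2 (x i.*2.+1) = d i.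
  by rewrite -(comb_Xn x) h2x comb_Xn /= odd_double uphalf_double.
pose rf y : D * D := (h1 y *+ p, h2 y); pose gf y : D * D := (0, h0 y).
have rfadd : GRing.zmod_morphism rf.
  by move=> y z; rewrite /rf !raddfB mulrnBl.
have gfadd : GRing.zmod_morphism gf.
  by move=> y z; rewrite /gf raddfB; congr (_, _); rewrite subrr.
pose r : {additive G -> D * D} :=
  HB.pack_for {additive G -> (D * D)%type} rf (GRing.isZmodMorphism.Build _ _ rf rfadd).
pose g : {additive G -> D * D} :=
  HB.pack_for {additive G -> (D * D)%type} gf (GRing.isZmodMorphism.Build _ _ gf gfadd).
have hF := spanned_subgroup x.
have [||rho [rhoF rhoid]] := generalized_bassian_projection (r := r) (g := g) gbG hF.
- move=> y; have [|i di] := dsurj (- h1 y); first by rewrite mulNrn h1q oppr0.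
  have [|j dj] := dsurj (h0 y - h2 y); first by rewrite mulrnBl h0q h2q subrr.
  exists (x i.*2 + x j.*2.+1); first by apply: subgroupD => //; exact: spanned_gen.
  rewrite /= /rf /gf !raddfD h1e h1o h2e h2o addr0 add0r di dj mulNrn.
  by congr (_, _); rewrite /= sub0r.
- move=> _ [a ->] [] /=; rewrite h0x => E.
  have /esym/prufer_gen_independent := E => /(_ p_pr).
  exact: comb_eq0.
(* The element [z - rho z] of [F] has the image [(p e_0, 0)] under [r]. *)
have [i di] := dsurj _ (ne 0%N); pose z := x i.*2.
have hpq y : h1 y *+ p *+ (p ^ k)%N = 0 by rewrite -mulrnA -expnS h1q.
have [a zE] : spanned x (z - rho z).
  by apply: subgroupB; [|exact: spanned_gen|have [] := rhoF z].
have zk : (z - rho z) *+ (p ^ k)%N = 0.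
  rewrite mulrnBl -raddfMn rhoid ?subrr //; first by apply: (subgroupMn hF); exact: spanned_gen.
  by rewrite raddfMn; apply/eqP; rewrite /= /rf /z h2e pairMn hpq mul0rn.
have pa j : (p %| a`_j)%Z.
  have : (q %| (a *+ p ^ k)`_j)%Z by apply: ind; exists 0; rewrite mul0rn (raddfMn (comb x)) /= -zE zk.
  rewrite coefMn -mulr_natr natz /q expnSr PoszM [_ * Posz p]mulrC dvdz_mul2r; last first.
    by rewrite eqz_nat -lt0n expn_gt0 prime_gt0.
  by [].
have [b ab] : exists b, a = b *+ p.
  exists (\poly_(j < size a) (a`_j %/ p)%Z); apply/polyP => j.
  rewrite coefMn coef_poly; case: ltnP => ja; last by rewrite nth_default // mul0rn.
  by rewrite -mulr_natr natz divzK.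
have /(congr1 fst) /= : r (z - rho z) = r z by rewrite raddfB (rhoF z).2 subr0.
rewrite h1e di zE ab raddfMn raddfMn => /(congr1 (fun v => v *+ (p ^ k.-1)%N)).
rewrite -!mulrnA -expnS prednK // -expnS h1q => E.
have := @prufer_gen_independent p p_pr (fun=> k.+1) (Posz (p ^ k))%:P.
rewrite comb_polyC -pmulrn -[prufer_gen _ _ _]/(e 0%N) -E => /(_ erefl 0%N).
rewrite coefC /= => /dvdn_leq; rewrite expn_gt0 prime_gt0 // => /(_ isT).
by rewrite leq_exp2l ?prime_gt1 // ltnn.
Qed.

(** * Finiteness tools *)

(** Each [R l] is a translate of a part of [C]. *)
Lemma finite_cosets (I : Type) (G : zmodType) (L : set I) (R : I -> G -> Prop)
    (C : set G) :
  finite_set L -> finite_set C ->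
  (forall l u v, R l u -> R l v -> C (u - v)) ->
  finite_set [set v | exists2 l, L l & R l v]%classic.
Proof.
move=> finL finC RC.
have fin_l l : finite_set (R l : set G).
  have [[v Rv]|nR] := pselect (exists v, R l v); last first.
    by rewrite (_ : R l = set0) // -subset0 => v Rv; apply: nR; exists v.
  apply: (@sub_finite_set _ _ [set w + v | w in C]%classic); last exact: finite_image.
  by move=> u Ru; exists (u - v); [exact: RC Ru Rv | rewrite subrK].
apply: sub_finite_set (bigcup_finite finL (fun l _ => fin_l l)).
by move=> v [l Ll Rv]; exists l.
Qed.

Lemma infinite_diff (T : choiceType) (A B : set T) :
  ~ finite_set A -> finite_set B -> exists2 x, A x & ~ B x.
Proof.
by move=> infA /(infinite_setD infA)/infinite_setN0[x [Ax nBx]]; exists x.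
Qed.

(** The coefficients have finitely many possible remainders modulo [q]. *)
Lemma comb_mod_finite (G : zmodType) (x : nat -> G) m q : (0 < q)%N ->
  exists2 L : set G, finite_set L & forall a : {poly int}, (size a <= m)%N ->
    exists2 b : {poly int}, (size b <= m)%N & L (comb x a - comb x b *+ q).
Proof.
case: q => // q _.
exists [set \sum_(i < m) x i *+ f i | f in [set: {ffun 'I_m -> 'I_q.+1}]]%classic.
  exact/finite_image/finite_finset.
move=> a am; exists (\poly_(i < m) (a`_i %/ q.+1)%Z); first exact: size_poly.
pose f : {ffun 'I_m -> 'I_q.+1} := [ffun i : 'I_m => inord (absz (a`_i %% q.+1)%Z)].
exists f => //.
rewrite (comb_widen _ am) (comb_widen _ (size_poly _ _)) -sumrMnl -sumrB.
apply: eq_bigr => i _; rewrite coef_poly ltn_ord ffunE inordK; last first.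
  by rewrite -ltz_nat gez0_abs ?modz_ge0 // ltz_pmod.
by rewrite pmulrn gez0_abs ?modz_ge0 // pmulrn -mulrzA -mulrzBr.
Qed.

Section SpanModulo.
Variables (G : zmodType) (H : G -> Prop) (x : nat -> G) (m : nat).

Definition span_mod (y : G) : Prop :=
  exists2 a : {poly int}, (size a <= m)%N & H (y - comb x a).

Lemma span_mod_subgroup : subgroup H -> subgroup span_mod.
Proof.
move=> hH; split.
  exists 0; first by rewrite size_poly0.
  by rewrite raddf0 subrr; apply: subgroup0.
move=> y z [a am Ha] [b bm Hb]; exists (a - b).
  by apply: leq_trans (size_polyD _ _) _; rewrite size_polyN geq_max am.
by rewrite raddfB subrACA; apply: subgroupB.
Qed.

End SpanModulo.

(** A subgroup [V] that misses the element of order [p] of the cyclic group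
    generated by [y] meets that group trivially. *)
Lemma socle_order (G : zmodType) p i (V : G -> Prop) (y : G) (c : int) :
  prime p -> subgroup V -> y *+ (p ^ i.+1)%N = 0 -> ~ V (y *+ (p ^ i)%N) ->
  V (y *~ c) -> ((p ^ i.+1)%N %| c)%Z.
Proof.
move=> p_pr hV yp nV Vc.
have step j : (j <= i.+1)%N -> ((p ^ j)%N %| c)%Z.
  elim: j => [|j IHj] ji; first by rewrite expn0 dvd1z.
  have /dvdzP[b cE] := IHj (ltnW ji).
  have [/dvdzP[b' bE]|pb] := boolP (p %| b)%Z.
    by rewrite cE bE expnS PoszM -mulrA dvdz_mull.
  have : coprimez p b by rewrite coprimezE prime_coprime.
  case/coprimezP => -[u v] /= uvE; case: nV.
  have -> : y *+ (p ^ i)%N = y *~ c *~ (v * (p ^ (i - j))%N).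
    have pij : Posz (p ^ i) = Posz (p ^ j) * Posz (p ^ (i - j)).
      by rewrite -PoszM -expnD subnKC.
    have E : Posz (p ^ i) = Posz (p ^ i.+1) * u + c * (v * Posz (p ^ (i - j))).
      by rewrite -[LHS]mulr1 -uvE cE expnS PoszM pij; ring.
    by rewrite pmulrn E mulrzDr mulrzA -pmulrn yp mul0rz add0r mulrzA.
  exact: subgroupMz.
exact: step.
Qed.

(** * Torsion of generalized Bassian groups *)

(** The elements of order dividing [p] and of height at least [k] in the
    p-component. *)
Definition layer (G : zmodType) (p k : nat) : set G :=
  [set x | exists2 y, y *+ (p ^ k.+1)%N = 0 & x = y *+ (p ^ k)%N]%classic.

Arguments layer : clear implicits.

Lemma layer_anti (G : zmodType) p j k : (j <= k)%N -> (layer G p k `<=` layer G p j)%classic.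
Proof.
move=> jk _ [y yp ->]; exists (y *+ (p ^ (k - j))%N); last first.
  by rewrite -mulrnA -expnD subnK.
by rewrite -mulrnA -expnD addnS subnK.
Qed.

(** If all the layers are infinite, one can choose [y_i] of order [p ^ i.+1] one
    after another, its multiple of order [p] being taken in the i-th layer and
    outside the finite group spanned by the former choices. *)
Lemma finite_layer_exists (G : zmodType) p : prime p -> generalized_bassian G ->
  exists k, finite_set (layer G p k).
Proof.
move=> p_pr gbG; apply: contrapT => inf.
have h0 : subgroup (eq (0 : G)) by split=> // _ _ <- <-; rewrite subrr.
have [|s sP|x indx nx] := @independent_exists G (eq 0) (fun i => p ^ i.+1)%N
    (fun i x => x *+ (p ^ i.+1)%N = 0).
- by [].
- set m := size s; have q_gt0 : (0 < p ^ m)%N by rewrite expn_gt0 prime_gt0.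
  have [L finL LP] := @comb_mod_finite G (nth 0 s) m _ q_gt0.
  have [|_ [y yp ->] nLy] := @infinite_diff _ (layer G p m) L _ finL.
    by move=> fin; apply: inf; exists m.
  exists y => // c a am E.
  have hV := span_mod_subgroup (nth 0 s) m h0.
  apply: (socle_order p_pr hV yp); last by exists a.
  move=> [b bm /esym/subr0_eq yb]; apply: nLy; rewrite yb.
  have [b' b'm] := LP b bm; rewrite (_ : comb _ b' *+ _ = 0) ?subr0 //.
  rewrite (comb_widen _ b'm) -sumrMnl big1 // => i _.
  rewrite pmulrn -mulrzA mulrC mulrzA -pmulrn.
  have := sP i (ltn_ord i); move/(congr1 (fun v => v *+ (p ^ (m - i.+1))%N)).
  by rewrite -mulrnA -expnD subnKC // => ->; rewrite mul0rn mul0rz.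
- exact: no_independent_unbounded p_pr gbG nx indx.
Qed.

(** If the layer [k] is infinite, choose elements of order [q = p ^ k.+1] one after
    another, the multiple of order [p] being outside the group [V] spanned by
    [q G] and the former choices. The socle of [V] is finite, because the next
    layer, which is the socle of [q G], is finite. *)
Lemma finite_layer_descent (G : zmodType) p k : prime p -> generalized_bassian G ->
  (0 < k)%N -> finite_set (layer G p k.+1) -> finite_set (layer G p k).
Proof.
move=> p_pr gbG k_gt0 fin; apply: contrapT => inf.
pose q := (p ^ k.+1)%N; have q_gt0 : (0 < q)%N by rewrite expn_gt0 prime_gt0.
pose H (y : G) := exists z, y = z *+ q.
have hH : subgroup H.
  split; first by exists 0; rewrite mul0rn.
  by move=> _ _ [y ->] [z ->]; exists (y - z); rewrite mulrnBl.
have [|s sP|x indx nx] := @independent_exists G H (fun=> q) (fun _ x => x *+ q = 0).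
- by [].
- set m := size s; have [L finL LP] := @comb_mod_finite G (nth 0 s) m _ q_gt0.
  have finV : finite_set [set v | exists2 l, L l & v *+ p = 0 /\ H (v - l)]%classic.
    apply: (finite_cosets finL fin) => l u v [up [z uz]] [vp [w vw]].
    have uvE : u - v = (z - w) *+ q by rewrite mulrnBl -uz -vw subrACA subrr subr0.
    exists (z - w) => //.
    by rewrite expnSr mulrnA -uvE mulrnBl up vp subrr.
  have [_ [y yp ->] nVy] := @infinite_diff _ _ _ inf finV.
  exists y => // c a am Ha.
  have hV := span_mod_subgroup (nth 0 s) m hH.
  apply: (socle_order p_pr hV yp); last by exists a.
  move=> [b bm Hb]; apply: nVy; have [b' b'm Lb] := LP b bm; eexists; first exact: Lb.
  split; first by rewrite -mulrnA -expnSr.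
  by rewrite opprB addrCA addrC; apply: (subgroupD hH) => //; exists (comb (nth 0 s) b').
- exact: no_independent_bounded p_pr k_gt0 gbG nx indx.
Qed.

Lemma finite_layer1 (G : zmodType) p : prime p -> generalized_bassian G ->
  finite_set (layer G p 1).
Proof.
move=> p_pr gbG; have [k] := finite_layer_exists p_pr gbG.
elim: k => [|[//|k] IHk] fin; first exact: sub_finite_set (layer_anti _) fin.
exact/IHk/finite_layer_descent.
Qed.

(** The layers are eventually finite and decreasing, hence stationary from some
    [K] on; then [p ^ K] times the p-component is divisible, hence zero. *)
Lemma primary_bounded (G : zmodType) p : prime p -> generalized_bassian G ->
  exists m, forall (x : G) j, x *+ (p ^ j)%N = 0 -> x *+ (p ^ m)%N = 0.
Proof.
move=> p_pr gbG; have [k /finite_seqP[s sE]] := finite_layer_exists p_pr gbG.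
have [K stat] : exists K, forall u, layer G p K u -> forall j, layer G p j u.
  suff [K KP] : exists K, forall u, u \in s -> layer G p K u -> forall j, layer G p j u.
    exists (maxn k K) => u Ku; apply: KP; last exact: layer_anti (leq_maxr k K) _ Ku.
    by have := layer_anti (leq_maxl k K) Ku; rewrite sE.
  elim: {sE} s => [|v s [K IHs]]; first by exists 0%N.
  have [all|] := pselect (forall j, layer G p j v).
    by exists K => u; rewrite inE => /predU1P[->//|]; apply: IHs.
  move/existsNP => [j nj]; exists (maxn j K) => u; rewrite inE => /predU1P[->|us] Ku.
    by case: nj; apply: layer_anti (leq_maxl j K) _ Ku.
  by apply: IHs => //; apply: layer_anti (leq_maxr j K) _ Ku.
pose W w := exists t, (exists j, t *+ (p ^ j)%N = 0) /\ w = t *+ (p ^ K)%N :> G.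
have hW : subgroup W.
  split; first by exists 0; rewrite !mul0rn; split=> //; exists 0%N.
  move=> _ _ [t [[i ti] ->]] [t' [[j tj] ->]]; exists (t - t').
  rewrite !mulrnBl; split=> //; exists (i + j)%N.
  by rewrite mulrnBl {1}expnD mulrnA ti addnC expnD mulrnA tj !mul0rn subrr.
have Wp w : W w -> exists j, w *+ (p ^ j)%N = 0.
  by move=> [t [[j tj] ->]]; exists j; rewrite -mulrnA mulnC mulrnA tj mul0rn.
suff Wdiv w : W w -> exists2 v, W v & w = v *+ p.
  exists K => x j xj; apply: (no_divisible_primary p_pr gbG hW Wp Wdiv).
  by exists x; split=> //; exists j.
move=> Ww; have [j wj] := Wp w Ww; elim: j w wj Ww => [|j IHj] w wj Ww.
  by exists 0; [exact: subgroup0 | move: wj; rewrite mulr1n mul0rn].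
have [t [_ wE]] := Ww.
have uK : layer G p (K + j) (w *+ (p ^ j)%N).
  exists t; last by rewrite wE -mulrnA -expnD.
  by rewrite -addnS expnD mulrnA -wE.
have [t' tp' uE] := stat _ (layer_anti (leq_addr j K) uK) (K + j).+1.
have Wt : W (t' *+ (p ^ K)%N) by exists t'; split=> //; eexists; exact: tp'.
have [||v Wv vE] := IHj (w - t' *+ (p ^ K)%N *+ p).
- by rewrite mulrnBl uE -(mulrnA _ p) -expnS -mulrnA -expnD addnS subrr.
- by apply: subgroupB => //; apply: subgroupMn.
exists (v + t' *+ (p ^ K)%N); first exact: subgroupD.
by rewrite mulrnDl -vE subrK.
Qed.

(** Otherwise one can choose successively the members of an infinite independent
    family of elements of infinite order. *)
Lemma finite_rank (G : zmodType) : generalized_bassian G ->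
  exists s : seq G, forall x, exists2 c : int, c != 0 &
    span_mod (eq 0) (nth 0 s) (size s) (x *~ c).
Proof.
move=> gbG; apply: contrapT => nfin.
have [//|s _|x indx _] := @independent_exists G (eq 0) (fun=> 0%N) (fun _ _ => True);
    last first.
- exact: no_independent_torsion_free gbG indx.
- have /existsNP[x nx] : ~ forall x, exists2 c : int, c != 0 &
      span_mod (eq 0) (nth 0 s) (size s) (x *~ c).
    by move=> H; apply: nfin; exists s.
  exists x => // c a am E; rewrite dvd0z; apply: contrapT => /negP c0.
  by apply: nx; exists c => //; exists a.
Qed.

(** [V], the part of the socle [G[p]] inside [p G + Y], is finite modulo the
    first layer, hence finite. A complement [N] of [V] in [G[p]] meets
    [p G + Y] trivially, hence is a summand of [G]: a subgroup that meets
    trivially a subgroup [U] containing [p G] has a complement containing [U]. *)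
Lemma primary_projection (G : zmodType) p (s : seq G) :
  prime p -> generalized_bassian G ->
  exists rho : {additive G -> G},
    [/\ forall x, rho x *+ p = 0, forall x, rho (rho x) = rho x,
        forall x, span_mod (eq 0) (nth 0 s) (size s) x -> rho x = 0
      & finite_set [set x | x *+ p = 0 /\ rho x = 0]%classic].
Proof.
move=> p_pr gbG; set y := nth 0 s; set m := size s.
pose P (x : G) := x *+ p = 0.
have hP : subgroup P.
  by split=> [|u v]; rewrite /P ?mul0rn // mulrnBl => -> ->; rewrite subrr.
pose pG (x : G) := exists z, x = z *+ p.
have hpG : subgroup pG.
  split; first by exists 0; rewrite mul0rn.
  by move=> _ _ [u ->] [v ->]; exists (u - v); rewrite mulrnBl.
pose U := span_mod pG y m; have hU : subgroup U by apply: span_mod_subgroup.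
have pU x : U (x *+ p).
  exists 0; first by rewrite size_poly0.
  by rewrite raddf0 subr0; exists x.
pose V x := P x /\ U x.
have hV : subgroup V.
  split; first by split; [exact: (subgroup0 hP) | exact: subgroup0].
  by move=> u v [Pu Uu] [Pv Uv]; split; [exact: (subgroupB hP) | exact: subgroupB].
have h0 : subgroup (eq (0 : G)) by split=> // _ _ <- <-; rewrite subrr.
have finV : finite_set (V : set G).
  have [L finL LP] := @comb_mod_finite G y m _ (prime_gt0 p_pr).
  have := finite_cosets finL (finite_layer1 p_pr gbG) (R := fun l v => P v /\ pG (v - l)).
  move=> fin; apply: sub_finite_set (fin _) => [v [Pv [a am Ha]]|l u v].
    have [b bm Lb] := LP a am; eexists; first exact: Lb.
    split=> //; rewrite opprB addrCA addrC; apply: (subgroupD hpG) => //.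
    by exists (comb y b).
  move=> [Pu [z uz]] [Pv [w vw]].
  have uvE : u - v = (z - w) *+ p by rewrite mulrnBl -uz -vw subrACA subrr subr0.
  exists (z - w); last by rewrite expn1.
  by rewrite expnS expn1 mulrnA -uvE; apply: (subgroupB hP).
have [||||N [hN _ NP NV0 NV]] := complement_prime p_pr hP h0 hV.
- by move=> _ <-; exact: (subgroup0 hP).
- by move=> x [].
- by [].
- by move=> x ->.
have [|//|//|||K [hK UK _ KN0 KN]] := complement_prime (P := fun=> True) p_pr _ hU hN.
- by [].
- by move=> x Ux Nx; apply: NV0 => //; split=> //; apply: NP.
- by move=> x _; apply: pU.
have [rho [rhoN rhoK rhoid rho0]] :=
  projection_exists hK hN KN0 (fun x => KN x I).
exists rho; split=> [x|x|x [a am Ha]|]; first exact/NP/rhoN.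
- exact/rhoid/rhoN.
- by apply/rho0/UK; exists a => //; rewrite -Ha; exists 0; rewrite mul0rn.
apply: sub_finite_set finV => x [xp rx].
have [n [v [Nn Vv xE]]] := NV x xp; rewrite xE.
suff -> : n = 0 by rewrite add0r.
move: rx; rewrite xE raddfD (rhoid n Nn) (rho0 v) ?addr0 //.
by apply/UK; case: Vv.
Qed.

(** * A criterion for Bassian groups *)

Lemma coprime_torsion_eq0 (G : zmodType) (w : G) m n :
  coprime m n -> w *+ m = 0 -> w *+ n = 0 -> w = 0.
Proof.
move=> mn wm wn; have [c ->] := coprime_divisible mn wn.
by rewrite pmulrn -mulrzA mulrC mulrzA -pmulrn wm mul0rz.
Qed.

Lemma comb_mulX (G : zmodType) (x : nat -> G) a :
  comb x (a * 'X) = comb (fun i => x i.+1) a.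
Proof.
rewrite (@comb_widen _ _ (size a).+1).
  rewrite big_ord_recl coefMX eqxx mulr0z add0r.
  by apply: eq_bigr => i _; rewrite coefMX.
have [->|a0] := eqVneq a 0; first by rewrite mul0r size_poly0.
by rewrite size_mulX.
Qed.

(** The iterates of a lifting of [f] at an element of infinite order of [N] would
    be an infinite independent family: modulo [N] the first one vanishes and
    the others are, up to the injection [f], the same family shifted. *)
Lemma bassian_kernel_torsion (A : zmodType) (N : zmodClosed A)
    (f : {additive A -> Quotient.quot N}) :
  (forall x : nat -> A, ~ independent (eq 0) (fun=> 0%N) x) -> injective f ->
  forall n, n \in N -> exists2 m, (0 < m)%N & n *+ m = 0.
Proof.
move=> noind finj n Nn; apply: contrapT => ntor.
have nfree (c : int) : n *~ c = 0 -> c = 0.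
  move=> nc; apply/eqP; apply: contrapT => /negP c0; apply: ntor; exists (absz c).
    by rewrite absz_gt0.
  by rewrite pmulrn abszE normrEsg mulrC mulrzA nc mul0rz.
pose x i := iter i (fun a => repr (f a)) n.
pose q : {additive A -> Quotient.quot N} := \pi_(Quotient.quot N).
have xS i : q (x i.+1) = f (x i) by rewrite /= reprK.
have x0 : q (x 0%N) = 0.
  by rewrite -(raddf0 q); apply/eqP; rewrite -Quotient.idealrBE subr0.
suff ind a : comb x a = 0 -> a = 0.
  by apply: (noind x) => a /esym/ind -> i; rewrite coef0 dvdz0.
elim/poly_ind: a => // a c IHa; rewrite raddfD /= comb_mulX comb_polyC => E.
have /IHa a0 : comb x a = 0.
  apply: finj; rewrite raddf0 raddf_comb.
  have := congr1 q E; rewrite (raddfD q) (raddfMz q) x0 mul0rz addr0 (raddf0 q).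
  by rewrite (raddf_comb q) => <-; apply: eq_comb_size => i _; exact: esym (xS i).
rewrite a0 mul0r add0r; move: E; rewrite a0 raddf0 add0r => /nfree->.
by rewrite polyC0.
Qed.

(** Since [N] is torsion, [f] lifts to an injective self-map of the finite
    p-component of [A]; this map is onto, and sends only [0] into [N]. *)
Lemma bassian_finite (A : zmodType) :
  (forall x : nat -> A, ~ independent (eq 0) (fun=> 0%N) x) ->
  (forall p, prime p -> finite_set [set x : A | exists j, x *+ (p ^ j)%N = 0]%classic) ->
  bassian A.
Proof.
move=> noind finT N [f finj].
pose q : {additive A -> Quotient.quot N} := \pi_(Quotient.quot N).
have Ntor := bassian_kernel_torsion noind finj.
have piN y : q y = 0 -> y \in N.
  by rewrite -(raddf0 q) => /eqP; rewrite -Quotient.idealrBE subr0.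
have Npi y : y \in N -> q y = 0.
  by move=> Ny; rewrite -(raddf0 q); apply/eqP; rewrite -Quotient.idealrBE subr0.
have Nsocle p n : prime p -> n \in N -> n *+ p = 0 -> n = 0.
  move=> p_pr Nn np; have /finite_seqP[t tE] := finT p p_pr.
  have inT x : (x \in t) <-> exists j, x *+ (p ^ j)%N = 0.
    by have /= -> := congr1 (fun S : set A => S x) tE.
  have lift x : exists y, x \in t -> y \in t /\ q y = f x.
    have [/inT[j xj]|xt] := pselect (x \in t); last by exists 0 => /xt.
    pose z := repr (f x); have zx : q z = f x by apply: reprK.
    have /piN/Ntor[m m_gt0 zm] : q (z *+ (p ^ j)%N) = 0.
      by rewrite (raddfMn q) zx -raddfMn xj raddf0.
    have [m' pm' mE] : {m' | coprime p m' & m = (m' * p ^ logn p m)%N}.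
      exact: pfactor_coprime.
    have fxj : f x *+ (p ^ j)%N = 0 by rewrite -raddfMn xj raddf0.
    have [|c fxE] := coprime_divisible _ fxj (m := m').
      by rewrite coprime_sym coprimeXl.
    exists (z *~ c *+ m') => _; split; last by rewrite (raddfMn q) (raddfMz q) zx.
    apply/inT; exists (j + logn p m)%N.
    rewrite -[RHS](mul0rz _ c) -zm !pmulrn -!mulrzA expnD [in RHS]mE !PoszM.
    by congr (_ *~ _); ring.
  have [F FP] := @choice _ _ _ lift.
  have FK x : x \in t -> F x \in N -> x = 0.
    by move=> xt /Npi; rewrite (FP x xt).2 => fx0; apply: finj; rewrite fx0 raddf0.
  have t0 : 0 \in t by apply/inT; exists 0%N; rewrite mul0rn.
  have nt : n \in t by apply/inT; exists 1%N; rewrite expn1.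
  pose u := undup t; have uu : uniq (map F u).
    rewrite map_inj_in_uniq ?undup_uniq // => x y; rewrite !mem_undup => xt yt E.
    by apply: finj; rewrite -(FP x xt).2 -(FP y yt).2 E.
  have [||_ uE] := uniq_min_size (s2 := u) uu.
  - by move=> _ /mapP[x xu ->]; move: xu; rewrite !mem_undup => /FP[].
  - by rewrite size_map.
  have im y : y \in t -> y \in N -> y = F 0.
    rewrite -mem_undup -uE => /mapP[x xu ->] NFx; congr F; apply: FK => //.
    by rewrite -mem_undup.
  by rewrite (im n nt Nn) -(im 0 t0 (rpred0 _)).
move=> n; rewrite inE; apply/idP/eqP => [Nn|->]; last exact: rpred0.
have [m] := Ntor n Nn; elim/ltn_ind: m => m IHm m_gt0 nm.
have [m1|m1] := leqP m 1; first by move: nm; have -> : m = 1%N by apply/eqP; rewrite eqn_leq m1.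
have p_pr := pdiv_prime m1.
have mE : (m = m %/ pdiv m * pdiv m)%N by rewrite divnK // pdiv_dvd.
apply: (IHm (m %/ pdiv m)%N); first by rewrite ltn_Pdiv // prime_gt1.
  by rewrite divn_gt0 ?prime_gt0 // pdiv_leq.
apply: (Nsocle _ _ p_pr); first exact: rpredMn.
by rewrite -mulrnA -mE.
Qed.

(** * Splitting off an elementary summand *)

Lemma split_idempotent (G : zmodType) (rho : {additive G -> G})
    (hK : subgroup (fun x => rho x = 0)) (hI : subgroup (fun x => rho x = x)) :
  (forall x, rho (rho x) = rho x) ->
  exists f : {additive G ->
      (subgroup_type (zmodClosed_of hK) * subgroup_type (zmodClosed_of hI))%type},
    bijective f.
Proof.
move=> rhoid.
pose A : zmodType := subgroup_type (zmodClosed_of hK).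
pose E : zmodType := subgroup_type (zmodClosed_of hI).
have inA x : x - rho x \in zmodClosed_of hK.
  by apply/asboolP; rewrite raddfB rhoid subrr.
have inE x : rho x \in zmodClosed_of hI by apply/asboolP; exact: rhoid.
pose f x : (A * E)%type := ((Sub (x - rho x) (inA x) : A), (Sub (rho x) (inE x) : E)).
have fadd : GRing.zmod_morphism f.
  move=> x y; congr (_, _); apply: val_inj.
    rewrite -[LHS]/(x - y - rho (x - y)) raddfB subrACA.
    exact/esym/(raddfB val (f x).1 (f y).1).
  rewrite -[LHS]/(rho (x - y)) raddfB; exact/esym/(raddfB val (f x).2 (f y).2).
exists (HB.pack_for {additive G -> (A * E)%type} f (GRing.isZmodMorphism.Build _ _ f fadd)).
exists (fun u : A * E => val u.1 + val u.2) => [x|[a e]]; first exact: subrK.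
have ra : rho (val a) = 0 by apply/asboolP; exact: (valP a).
have re : rho (val e) = val e by apply/asboolP; exact: (valP e).
congr (_, _); apply: val_inj.
  by rewrite -[LHS]/(val a + val e - rho (val a + val e)) raddfD ra re add0r addrK.
by rewrite -[LHS]/(rho (val a + val e)) raddfD ra re add0r.
Qed.

(** For distinct primes [p] and [q], the values of [rho_ p] on the image of
    [rho_ q] are killed by both [p] and [q], hence vanish: the [rho_ p] are
    orthogonal idempotents. *)
Lemma sum_primary_projections (G : zmodType) (rho_ : nat -> {additive G -> G}) :
  (forall p x, prime p -> rho_ p x *+ p = 0) ->
  (forall p x, prime p -> rho_ p (rho_ p x) = rho_ p x) ->
  (forall x, exists b, forall p, prime p -> (b <= p)%N -> rho_ p x = 0) ->
  exists rho : {additive G -> G},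
    [/\ forall x, exists b, rho x = \sum_(p < b | prime p) rho_ p x,
        forall x, rho (rho x) = rho x
      & forall p x, prime p -> rho_ p (rho x) = rho_ p x].
Proof.
move=> rp rid rfin; have [b bP] := @choice _ _ _ rfin.
pose f x := \sum_(p < b x | prime p) rho_ p x.
have fE n x : (b x <= n)%N -> f x = \sum_(p < n | prime p) rho_ p x.
  move=> bn; rewrite /f (big_ord_widen_cond n (fun p => prime p) (fun p => rho_ p x)) //.
  rewrite big_mkcondr; apply: eq_bigr => p p_pr; case: ltnP => // bp.
  by rewrite bP.
have fadd : GRing.zmod_morphism f.
  move=> x y; pose n := maxn (b (x - y)) (maxn (b x) (b y)).
  rewrite !(fE n) ?leq_max ?leqnn ?orbT // -sumrB.
  by apply: eq_bigr => p _; rewrite raddfB.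
have rf p x : prime p -> rho_ p (f x) = rho_ p x.
  move=> p_pr; pose n := maxn (b x) p.+1.
  have pn : (p < n)%N by rewrite leq_max leqnn orbT.
  rewrite (fE n) ?leq_maxl // raddf_sum (bigD1 (Ordinal pn)) //= rid // big1 ?addr0 //.
  move=> q /andP[q_pr qp]; apply: (@coprime_torsion_eq0 _ _ p q).
  - rewrite prime_coprime // dvdn_prime2 //; apply: contraNneq qp => qp.
    exact/eqP/val_inj.
  - exact: rp.
  - by rewrite -raddfMn rp // raddf0.
exists (HB.pack_for {additive G -> G} f (GRing.isZmodMorphism.Build _ _ f fadd)).
split=> [x|x|p x p_pr] /=; [by exists (b x) | | exact: rf].
pose n := maxn (b (f x)) (b x).
rewrite [LHS](fE n) ?leq_maxl // [RHS](fE n) ?leq_maxr //.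
by apply: eq_bigr => p; apply: rf.
Qed.

(** An endomorphism killing [Y] and with values of order dividing [p] kills any
    [x] having a multiple [c x] in [Y] with [c] prime to [p]. *)
Lemma primary_projections_exist (G : zmodType) : generalized_bassian G ->
  exists rho_ : nat -> {additive G -> G},
    [/\ forall p x, prime p -> rho_ p x *+ p = 0,
        forall p x, prime p -> rho_ p (rho_ p x) = rho_ p x,
        forall x, exists b, forall p, prime p -> (b <= p)%N -> rho_ p x = 0
      & forall p, prime p ->
          finite_set [set x | x *+ p = 0 /\ rho_ p x = 0]%classic].
Proof.
move=> gbG; have [s sP] := finite_rank gbG.
have [p|rho_ rhoP] := @choice nat {additive G -> G} (fun p rho => prime p ->
    [/\ forall x, rho x *+ p = 0, forall x, rho (rho x) = rho x,
        forall x, span_mod (eq 0) (nth 0 s) (size s) x -> rho x = 0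
      & finite_set [set x | x *+ p = 0 /\ rho x = 0]%classic]).
  have [p_pr|np] := boolP (prime p); last by exists idfun => p_pr; case/negP: np.
  by have [rho hrho] := primary_projection s p_pr gbG; exists rho.
exists rho_; split=> [p x p_pr|p x p_pr|x|p p_pr]; try by have [] := rhoP p p_pr.
have [c c0 Yc] := sP x; exists (absz c).+1 => p p_pr cp.
have [rp _ rY _] := rhoP p p_pr.
apply: (@coprime_torsion_eq0 _ _ p (absz c)) => //.
  by rewrite prime_coprime // gtnNdvd // absz_gt0.
by rewrite pmulrn abszE normrEsg mulrC mulrzA -raddfMz rY ?mul0rz.
Qed.

(** By induction on [j], the elements of [P] killed by [p ^ j] are finitely many:
    multiplication by [p] has finite fibres on [P]. *)
Lemma finite_primary (G : zmodType) (P : G -> Prop) p : subgroup P ->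
  finite_set [set x | P x /\ x *+ p = 0]%classic ->
  (exists m, forall (x : G) j, x *+ (p ^ j)%N = 0 -> x *+ (p ^ m)%N = 0) ->
  finite_set [set x | P x /\ exists j, x *+ (p ^ j)%N = 0]%classic.
Proof.
move=> hP fin [m mP].
suff finj j : finite_set [set x | P x /\ x *+ (p ^ j)%N = 0]%classic.
  apply: sub_finite_set (finj m) => x [Px [j xj]]; split=> //; exact: mP xj.
elim: j => [|j IHj].
  apply: sub_finite_set (finite_set1 (0 : G)) => x [_].
  by rewrite expn0 mulr1n.
have := finite_cosets IHj fin (R := fun l x => P x /\ x *+ p = l).
move=> fin'; apply: sub_finite_set (fin' _) => [x [Px xj]|l u v [Pu <-] [Pv uv]].
  exists (x *+ p) => //; split; first exact: (subgroupMn hP).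
  by rewrite -mulrnA -expnS.
by split; [exact: (subgroupB hP) | rewrite mulrnBl uv subrr].
Qed.

Theorem corollary3p6 (G : zmodType) :
  generalized_bassian G -> BplusE_group G.
Proof.
move=> gbG; have [rho_ [rp rid rfin rker]] := primary_projections_exist gbG.
have [rho [rhoE rhoid rho_rho]] := sum_primary_projections rp rid rfin.
have hK : subgroup (fun x => rho x = 0).
  by split=> [|x y]; rewrite ?raddf0 // raddfB => -> ->; rewrite subrr.
have hI : subgroup (fun x => rho x = x).
  by split=> [|x y]; rewrite ?raddf0 // raddfB => -> ->.
exists (subgroup_type (zmodClosed_of hK)), (subgroup_type (zmodClosed_of hI)).
have valK (a : subgroup_type (zmodClosed_of hK)) : rho (val a) = 0.
  by apply/asboolP; exact: (valP a).
have valI (a : subgroup_type (zmodClosed_of hI)) : rho (val a) = val a.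
  by apply/asboolP; exact: (valP a).
split; last exact: split_idempotent.
- apply: bassian_finite => [x indx|p p_pr].
    apply: (@no_independent_torsion_free G (val \o x) gbG) => a a0; apply: indx.
    apply: val_inj; apply: etrans (raddf0 val) _; apply: etrans a0 _.
    exact/esym/(raddf_comb val).
  have fin : finite_set [set x : G | rho x = 0 /\ exists j, x *+ (p ^ j)%N = 0]%classic.
    apply: finite_primary => //; last exact: primary_bounded.
    apply: sub_finite_set (rker p p_pr) => x [rx xp]; split=> //.
    by rewrite -rho_rho // rx raddf0.
  apply: sub_finite_set (finite_image (insubd (0 : subgroup_type (zmodClosed_of hK))) fin).
  move=> x [j xj]; exists (val x); last exact: valKd.
  by split; [exact: valK | exists j; rewrite -raddfMn xj raddf0].
- split=> [e|p p_pr e [k ek]].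
    have [b bE] := rhoE (val e); exists b`!; first exact: fact_gt0.
    apply: val_inj; rewrite raddfMn raddf0 /= -valI bE -sumrMnl big1 // => p p_pr.
    have /dvdnP[c ->] : (p %| b`!)%N by rewrite dvdn_fact // prime_gt0 //= ltnW.
    by rewrite mulnC mulrnA rp // mul0rn.
  apply: val_inj; have [b bE] := rhoE (val e).
  rewrite raddfMn raddf0 /= -valI bE -sumrMnl big1 // => q q_pr.
  have [<-|qp] := eqVneq (q : nat) p; first exact: rp.
  rewrite (@coprime_torsion_eq0 _ (rho_ q (val e)) q (p ^ k)) ?mul0rn //.
  + by rewrite coprimeXr // prime_coprime // dvdn_prime2.
  + exact: rp.
  + by rewrite -raddfMn -raddfMn ek !raddf0.
Qed.
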